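(* Let $G$ be a finite abelian group, written multiplicatively, with $|G|>1$ and identity element $e$. Let $k$ be a positive integer, let $a\neq e$ be an element of $G$ and let $b_1,\ldots,b_k$ be (not necessarily distinct) elements of $G$. If $k<p(G)$, then there is a permutation $\pi\in S_k$ such that the products $a^ib_{\pi(i)}$ $(i=1,\ldots,k)$ are pairwise distinct.
   Context: $S_k$ is the symmetric group on $\{1,\ldots,k\}$. For a finite group $G$ with $|G|>1$, $p(G)$ denotes the smallest prime divisor of $|G|$. *)

(* Defs.v *)
From mathcomp Require Export all_boot all_fingroup.

(* Main.v *)
Require Import Defs.
From mathcomp Require Import all_algebra all_solvable all_field all_character.

(** The permutation is found with the help of a complex character [chi] of
    [G] of [p]-power order, [p] a prime divisor of [#|G|], that does not kill
    [a] ([exists_ppower_char_neq1]); since [k] is less than every prime divisor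
    of [#|G|], it is less than [p].  Write [z = chi a] and [w j = chi (b j)]
    for [0 <= j < k].  It is enough that the numbers [z ^ (j + 1) * w (pi j)]
    be pairwise distinct for some [pi], that is, that the Vandermonde
    determinant of this family be nonzero for some [pi].  Summed over all [pi],
    these determinants factor ([sum_det_Vandermonde]) as the product of
    - the Vandermonde determinant of the powers [z, z ^ 2, ..., z ^ k], which
      are distinct since the order of [z] is a nontrivial power of [p] and
      [p > k];
    - the permanent of the matrix [w j ^ i], which is a sum of [k!] roots of
      unity of [p]-power order.
    A vanishing sum of [N] roots of unity of order dividing [p ^ n] forces [p]
    to divide [N] ([dvdn_sum_unity_roots]): raise the sum to the power [p ^ n]
    and expand modulo [p] in the ring of algebraic integers.  As [p] does not
    divide [k!], the permanent is nonzero, hence so is one of the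
    determinants. *)

Set Implicit Arguments.
Unset Strict Implicit.
Unset Printing Implicit Defensive.

Import GRing.Theory.

Local Open Scope group_scope.

Section Frobenius.

Local Open Scope ring_scope.

Lemma eqAmodX (e x y : algC) (n : nat) : x \in Aint -> y \in Aint ->
  (x == y %[mod e])%A -> (x ^+ n == y ^+ n %[mod e])%A.
Proof.
move=> Ax Ay xy; elim: n => [|n IHn]; first by rewrite !expr0 eqAmod_refl.
by rewrite !exprS eqAmodM ?rpredX.
Qed.

Lemma eqAmod_Frobenius_add (p : nat) (x y : algC) : prime p ->
    x \in Aint -> y \in Aint ->
  ((x + y) ^+ p == x ^+ p + y ^+ p %[mod p%:R])%A.
Proof.
case: p => [|p] // p_pr Ax Ay.
rewrite exprDn big_ord_recl big_ord_recr /= subn0 subnn !expr0 mulr1 mul1r.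
rewrite bin0 binn !mulr1n eqAmodDl -[X in eqAmod _ _ X]add0r eqAmodDr eqAmod0.
apply: (@rpred_sum _ (dvdA p.+1%:R)) => i _; rewrite -eqAmod0.
have: (p.+1 %| 'C(p.+1, bump 0 i))%N.
  by rewrite prime_dvd_bin //= /bump leq0n add1n ltnS ltn_ord.
case/dvdnP=> c ->.
rewrite -[_ *+ (c * _)]mulr_natr natrM mulrA eqAmodMl0 //.
by rewrite !rpredM ?rpredX // Aint_Cnat ?natr_nat.
Qed.

Lemma eqAmod_Frobenius_sum (I : finType) (p : nat) (x : I -> algC) : prime p ->
    (forall i, x i \in Aint) ->
  ((\sum_i x i) ^+ p == \sum_i x i ^+ p %[mod p%:R])%A.
Proof.
move=> p_pr Ax.
suff []: \sum_i x i \in Aint /\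
  ((\sum_i x i) ^+ p == \sum_i x i ^+ p %[mod p%:R])%A by [].
elim/big_rec2: _ => [|i s t _ [At IH]].
  by rewrite expr0n gtn_eqF ?prime_gt0 // rpred0 eqAmod_refl.
split; first by rewrite rpredD.
apply: (eqAmod_trans (eqAmod_Frobenius_add p_pr (Ax i) At)).
by rewrite eqAmodDl.
Qed.

Lemma eqAmod_Frobenius_iter (I : finType) (p n : nat) (x : I -> algC) :
    prime p -> (forall i, x i \in Aint) ->
  ((\sum_i x i) ^+ (p ^ n) == \sum_i x i ^+ (p ^ n) %[mod p%:R])%A.
Proof.
move=> p_pr Ax; elim: n => [|n IHn].
  by rewrite expn0 expr1 (eq_bigr x) // eqAmod_refl.
have AxX i : x i ^+ (p ^ n) \in Aint by rewrite rpredX.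
have ->: \sum_i x i ^+ (p ^ n.+1) = \sum_i (x i ^+ (p ^ n)) ^+ p.
  by apply: eq_bigr => i _; rewrite expnSr exprM.
rewrite expnSr exprM; apply: (eqAmod_trans _ (eqAmod_Frobenius_sum p_pr AxX)).
by apply: eqAmodX IHn; rewrite ?rpredX ?rpred_sum.
Qed.

(** The sum is congruent modulo [p], after raising it to the power [p ^ n], to
    the number of its terms; a rational integer divisible by [p] among the
    algebraic integers is divisible by [p]. *)
Lemma dvdn_sum_unity_roots (I : finType) (p n : nat) (x : I -> algC) :
    prime p -> (forall i, x i ^+ (p ^ n) = 1) -> \sum_i x i = 0 ->
  (p %| #|I|)%N.
Proof.
move=> p_pr x1 sum0; have pn_gt0: (0 < p ^ n)%N by rewrite expn_gt0 prime_gt0.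
have Ax i : x i \in Aint.
  by apply: (Aint_unity_root pn_gt0); apply/unity_rootP.
have := eqAmod_Frobenius_iter n p_pr Ax.
rewrite sum0 expr0n gtn_eqF // (eq_bigr (fun=> 1)) // sumr_const.
by rewrite eqAmod_sym eqAmod0_nat.
Qed.

(** The order of [z] is a nontrivial power of [p], hence at least [p]. *)
Lemma expr_inj_lt_prime (p n : nat) (z : algC) : prime p ->
    z ^+ (p ^ n) = 1 -> z != 1 ->
  {in [pred i : nat | (i < p)%N] &, injective (fun i => z ^+ i)}.
Proof.
move=> p_pr zpn z_neq1 i j; rewrite !inE => lt_ip lt_jp /eqP.
have pn_gt0: (0 < p ^ n)%N by rewrite expn_gt0 prime_gt0.
have [m z_m /(dvdn_pfactor _ _ p_pr)[[|e] _ def_m]] :=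
  prim_order_exists pn_gt0 zpn.
  by rewrite -(prim_expr_order z_m) def_m expn0 expr1 eqxx in z_neq1.
have le_pm: (p <= m)%N by rewrite def_m expnS leq_pmulr ?expn_gt0 ?prime_gt0.
rewrite (eq_prim_root_expr z_m) !modn_small ?(leq_trans _ le_pm) //.
by move/eqP.
Qed.

End Frobenius.

Lemma prime_dvdn_fact (p m : nat) : prime p -> (p %| m`!)%N -> (p <= m)%N.
Proof.
move=> p_pr; elim: m => [|m IHm]; first by rewrite fact0 Euclid_dvd1.
by rewrite factS Euclid_dvdM // => /orP[/dvdn_leq-> // | /IHm/leqW].
Qed.

Section Vandermonde.

Local Open Scope ring_scope.

(** In the Leibniz expansions, the factors [w] contribute for each permutation
    [s] the sum over [pi] of the products of the [w (pi (s i)) ^+ i].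
    Translating [pi] by [s] shows that this sum does not depend on [s]. *)
Lemma sum_det_Vandermonde (R : comPzRingType) (k : nat) (u w : 'I_k -> R) :
  \sum_(pi : 'S_k) \det (Vandermonde k (\row_j (u j * w (pi j)))) =
  \det (Vandermonde k (\row_j u j)) * \sum_(pi : 'S_k) \prod_i w (pi i) ^+ i.
Proof.
rewrite /determinant exchange_big mulr_suml; apply: eq_bigr => s _ /=.
rewrite -mulrA -mulr_sumr; congr (_ * _).
rewrite [X in _ * X](reindex_inj (mulgI s)) mulr_sumr; apply: eq_bigr => pi _.
rewrite -big_split; apply: eq_bigr => i _ /=.
by rewrite !mxE permM exprMn.
Qed.

Lemma det_Vandermonde_neq0P (R : idomainType) (k : nat) (u : 'I_k -> R) :
  reflect (injective u) (\det (Vandermonde k (\row_j u j)) != 0).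
Proof.
rewrite det_Vandermonde; apply: (iffP idP) => [nz i j eq_u | inj_u].
  apply/val_inj; wlog lt_ij: i j eq_u / (i < j)%N.
    by move=> IH; case: (ltngtP i j) => // [/IH | /IH <-] //; apply.
  case/negP: nz; apply/eqP; rewrite (bigD1 i) //= (bigD1 j) //= !mxE eq_u.
  by rewrite subrr !mul0r.
apply/prodf_neq0 => i _; apply/prodf_neq0 => j lt_ij.
by rewrite !mxE subr_eq0 (inj_eq inj_u) -val_eqE gtn_eqF.
Qed.

End Vandermonde.

(** Compose a linear character of [G] with the projection of [G] on its Sylow
    [p]-subgroup, for a prime divisor [p] of the order of [a]: then [a] has a
    nontrivial projection, which some irreducible character does not kill. *)
Lemma exists_ppower_char_neq1 (gT : finGroupType) (G : {group gT}) (a : gT) :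
    abelian G -> a \in G -> a != 1 ->
  exists p n : nat, exists chi : gT -> algC,
    [/\ prime p /\ (p %| #|G|)%N,
        {in G &, {morph chi : x y / x * y >-> (x * y)%R}},
        {in G, forall x, (chi x ^+ (p ^ n) = 1)%R} & chi a != 1%R].
Proof.
move=> abG aG a_neq1; pose p := pdiv #[a].
have p_pr: prime p by rewrite pdiv_prime // order_gt1.
have ap_neq1: a.`_p != 1.
  apply: contraTneq (pdiv_dvd #[a]) => /constt1P.
  by rewrite /p_elt p'natE.
have constt_in x : x \in G -> x.`_p \in G by apply: groupX.
have [i chi_ap]: exists i, a.`_p \notin cfker ('chi[G]_i)%R.
  apply/existsP; apply: contraR ap_neq1 => /existsPn ker_a.
  have: a.`_p \in \bigcap_i cfker ('chi[G]_i)%R.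
    by apply/bigcapP => i _; apply/negbNE/ker_a.
  by rewrite TI_cfker_irr => /set1P ->.
have lin_i: ('chi_i)%R \is a linear_char by apply/char_abelianP.
exists p, (logn p #|G|), (fun x => ('chi_i)%R x.`_p); split.
- by split=> //; apply: dvdn_trans (pdiv_dvd _) (order_dvdG aG).
- move=> x y Gx Gy; rewrite consttM ?lin_charM ?constt_in //.
  exact: (centsP abG).
- move=> x Gx; rewrite -lin_charX ?constt_in //; set y := _ ^+ _.
  suff ->: y = 1 by apply: lin_char1.
  apply/eqP; rewrite -order_dvdn order_constt -p_part partn_dvd //.
  exact: order_dvdG.
- by move: chi_ap; rewrite cfkerEchar ?lin_charW // inE constt_in //= lin_char1.
Qed.

(* 'I_k = {0, ..., k-1} encodes the index set {1, ..., k}: the ordinal i stands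
   for the index i + 1, hence the exponent i.+1. *)
Theorem corollary1p8 (gT : finGroupType) (G : {group gT}) (abG : abelian G)
    (G_gt1 : (1 < #|G|)%N) (k : nat) (k_gt0 : (0 < k)%N)
    (a : gT) (aG : a \in G) (a_neq1 : a != 1)
    (b : 'I_k -> gT) (bG : forall i : 'I_k, b i \in G)
    (k_lt_p : (k < pdiv #|G|)%N) :
  exists pi : 'S_k, injective (fun i : 'I_k => a ^+ i.+1 * b (pi i)).
Proof.
have [p [n [chi [[p_pr p_dvG] chiM chi_pn chi_a]]]] :=
  exists_ppower_char_neq1 abG aG a_neq1.
have k_lt: (k < p)%N by rewrite (leq_trans k_lt_p) // pdiv_min_dvd ?prime_gt1.
have chiX m : chi (a ^+ m.+1) = (chi a ^+ m.+1)%R.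
  by elim: m => // m IHm; rewrite expgS chiM ?groupX // IHm -exprS.
pose u (j : 'I_k) := chi (a ^+ j.+1); pose w j := chi (b j).
have u_inj: injective u.
  move=> i j; rewrite /u !chiX.
  move/(expr_inj_lt_prime p_pr (chi_pn a aG) chi_a) => eq_ij.
  by apply/val_inj/succn_inj/eq_ij; rewrite inE (leq_ltn_trans (ltn_ord _)).
have perm_neq0: (\sum_(pi : 'S_k) \prod_i w (pi i) ^+ i != 0)%R.
  apply/eqP => /(dvdn_sum_unity_roots p_pr (n := n)) p_dv.
  have: (p %| k`!)%N.
    rewrite -(card_Sn k); apply: p_dv => pi.
    rewrite -prodrXl big1 // => i _.
    by rewrite exprAC chi_pn ?expr1n.
  by move/(prime_dvdn_fact p_pr); rewrite leqNgt k_lt.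
have: (\sum_(pi : 'S_k) \det (Vandermonde k (\row_j (u j * w (pi j)))) != 0)%R.
  by rewrite sum_det_Vandermonde mulf_neq0 //; apply/det_Vandermonde_neq0P.
have [/existsP[pi det_pi] _ | /existsPn det0] := boolP
  [exists pi : 'S_k, (\det (Vandermonde k (\row_j (u j * w (pi j)))) != 0)%R].
  exists pi; move/det_Vandermonde_neq0P: det_pi => inj_uw i j eq_ij.
  by apply: inj_uw; rewrite -!chiM ?groupX // eq_ij.
by rewrite big1 ?eqxx // => pi _; apply/eqP; rewrite -[_ == _]negbK det0.
Qed.
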